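(* Let $\mathcal{H}$ be a Hilbert space of finite dimension $d$ with fixed computational basis $\{|j\rangle\}_{j=1}^d$, and let $|f_1\rangle=\frac{1}{\sqrt d}\sum_{j=1}^d|j\rangle$. For any density matrix $\rho$ on $\mathcal{H}$ and any two parameters $\alpha_1,\alpha_2\in[\frac12,1)$ with $\alpha_1\geqslant\alpha_2$, $$\mathcal{T}^{\mathrm{R}}_{\alpha_1}(\rho)\geqslant\mathcal{T}^{\mathrm{R}}_{\alpha_2}(\rho).$$
   Context: A density matrix is a positive semidefinite operator of trace one. The texture measure based on the sandwiched Rényi relative entropy is, for $\alpha\in[\frac12,1)$, $\mathcal{T}^{\mathrm{R}}_{\alpha}(\rho)=\frac{1}{1-\alpha}\Big[1-\big(\langle f_1|\rho^{\frac{1-\alpha}{\alpha}}|f_1\rangle\big)^{\frac{\alpha}{1-\alpha}}\Big]$, with powers of $\rho$ defined by functional calculus. *)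

(* Defs.v *)
From HB Require Import structures.
From mathcomp Require Import all_boot all_order all_algebra.
From mathcomp Require Import spectral sesquilinear.
From mathcomp Require Import complex.
From mathcomp Require Import reals exp.
Set Implicit Arguments.
Unset Strict Implicit.
Unset Printing Implicit Defensive.
Import Order.TTheory GRing.Theory Num.Theory.
Local Open Scope ring_scope.
Local Open Scope complex_scope.
Local Open Scope sesquilinear_scope.

(* The Hilbert space of dimension d is C^d (column vectors over R[i]); the
   computational basis vector |j> is [delta_mx j 0]. *)

(* The order of R[i] makes [0 <= z] mean that z is real and nonnegative. *)
Definition psdmx (R : realType) (d : nat) (A : 'M[R[i]]_d) : Prop :=
  A \is hermsymmx /\ forall v : 'cV[R[i]]_d, 0 <= (v^t* *m A *m v) 0 0.

Definition density_matrix (R : realType) (d : nat) (rho : 'M[R[i]]_d) : Prop :=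
  psdmx rho /\ \tr rho = 1.

(* Functional calculus for a real function on a Hermitian matrix.  The library
   picks one decomposition A = P^* diag(lambda) P with P unitary (the columns
   of P^* form an orthonormal eigenbasis); [mxfunE] below shows that the result
   does not depend on this choice.  The eigenvalues lambda are stored as complex
   numbers, real when A is Hermitian, hence the real part. *)
Definition mxfun (R : realType) (d : nat) (f : R -> R) (A : 'M[R[i]]_d) :
    'M[R[i]]_d :=
  let P := spectralmx A in
  P^t* *m diag_mx (map_mx (fun z => (f (complex.Re z))%:C) (spectral_diag A))
    *m P.

Lemma mxfunE (R : realType) (d : nat) (f : R -> R) (A U : 'M[R[i]]_d)
    (l : 'rV[R]_d) : U \is unitarymx ->
  A = U^t* *m diag_mx (map_mx (fun x => x%:C) l) *m U ->
  mxfun f A = U^t* *m diag_mx (map_mx (fun x => (f x)%:C) l) *m U.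
Proof.
move=> Uu eA; rewrite /mxfun; set P := spectralmx A; set s := spectral_diag A.
have Pu : P \is unitarymx := spectral_unitarymx A.
have UU : U *m U^t* = 1%:M by exact/unitarymxP.
have UU' : U^t* *m U = 1%:M by exact: mulmx1C.
have PP : P *m P^t* = 1%:M by exact/unitarymxP.
have PP' : P^t* *m P = 1%:M by exact: mulmx1C.
have An : A \is normalmx.
  by apply/orthomx_spectral_subproof; exists (U, map_mx (fun x => x%:C) l) => //=;
    rewrite eA invmx_unitary.
have As : A = P^t* *m diag_mx s *m P.
  by rewrite -invmx_unitary //; exact/orthomx_spectralP.
set W := P *m U^t*.
have eW : diag_mx s *m W = W *m diag_mx (map_mx (fun x => x%:C) l).
  have -> : diag_mx s *m W = P *m A *m U^t*.
    by rewrite /W As !mulmxA PP mul1mx.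
  by rewrite eA /W !mulmxA -(mulmxA _ U) UU mulmx1.
have {}eW : diag_mx (map_mx (fun z => (f (complex.Re z))%:C) s) *m W
    = W *m diag_mx (map_mx (fun x => (f x)%:C) l).
  apply/matrixP => i j; move/matrixP/(_ i j): eW.
  rewrite !mul_diag_mx !mul_mx_diag !mxE => e.
  have [->|W0] := eqVneq (\sum_k P i k * (U^t*) k j) 0; first by rewrite mulr0 mul0r.
  move: e; rewrite mulrC => /(mulfI W0) ->; exact: mulrC.
have eP : W *m U = P by rewrite /W -mulmxA UU' mulmx1.
have eU : U^t* = P^t* *m W by rewrite /W mulmxA PP' mul1mx.
rewrite eU; clearbody W; rewrite -!mulmxA.
by congr (_ *m _); rewrite mulmxA -eW -mulmxA eP.
Qed.

(* [powR] sends 0 to 0 for every nonzero exponent. *)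
Definition mxpow (R : realType) (d : nat) (A : 'M[R[i]]_d) (s : R) :
    'M[R[i]]_d :=
  mxfun (fun x => powR x s) A.

Definition f1 (R : realType) (d : nat) : 'cV[R[i]]_d :=
  ((Num.sqrt (d%:R : R))^-1)%:C *: \sum_(j < d) delta_mx j 0.

(* The expectation <v|A|v>, a real number when A is Hermitian. *)
Definition expect (R : realType) (d : nat) (v : 'cV[R[i]]_d)
    (A : 'M[R[i]]_d) : R :=
  complex.Re ((v^t* *m A *m v) 0 0).

Definition texture_renyi (R : realType) (d : nat) (alpha : R)
    (rho : 'M[R[i]]_d) : R :=
  (1 - alpha)^-1 *
  (1 - powR (expect (f1 R d) (mxpow rho ((1 - alpha) / alpha)))
            (alpha / (1 - alpha))).

(* Main.v *)
Require Import Defs.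
From mathcomp Require Import all_boot all_order all_algebra.
From mathcomp Require Import spectral sesquilinear.
From mathcomp Require Import complex reals.
From mathcomp Require Import exp ring lra.
Import Order.TTheory GRing.Theory Num.Theory.
Local Open Scope ring_scope.
Local Open Scope complex_scope.

(** With [s = (1 - alpha) / alpha], [w] the probability distribution of [f1]
    over an eigenbasis of [rho], and [l] the eigenvalues, the measure is
    [(1 - alpha)^-1 * (1 - M_s)], where [M_s] is the [w]-weighted power mean of
    [l] of order [s].  As [alpha] increases, [s] decreases, hence so does [M_s];
    it is at most 1 because the [l i] are nonnegative with sum 1.  Both factors
    are thus nonnegative and nondecreasing in [alpha]. *)

Section PowerMean.
Context {R : realType}.
Implicit Types (u p s t : R).

(** Young's inequality for [u] and [1] with conjugate exponents [p] and [p / (p - 1)]; the case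
    [p = 1], where the second exponent degenerates, is an equality. *)
Lemma powR_bernoulli u p : 0 <= u -> 1 <= p -> 1 + p * (u - 1) <= powR u p.
Proof.
move=> u0; rewrite le_eqVlt => /predU1P[<-|p1].
  by rewrite powRr1 // mul1r addrC subrK.
have p0 : 0 < p := lt_trans ltr01 p1.
have q0 : 0 < p / (p - 1) by rewrite divr_gt0 // subr_gt0.
have pq : p^-1 + (p / (p - 1))^-1 = 1.
  by rewrite invf_div -[X in X + _]div1r -mulrDl addrC subrK divff ?gt_eqF.
have := conjugate_powR u0 ler01 p0 q0 pq.
rewrite powR1 mulr1 div1r invf_div -mulrDl ler_pdivlMr //; lra.
Qed.

Context {I : finType} (w : I -> R).
Hypotheses (w0 : forall i, 0 <= w i) (w1 : \sum_i w i = 1).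

(** By convexity, each [powR (x i) p] lies above the tangent at the mean [m]. On averaging, the
    tangents give exactly [powR m p], because the weights sum to 1. *)
Lemma powR_jensen (x : I -> R) p : (forall i, 0 <= x i) -> 1 <= p ->
  powR (\sum_i w i * x i) p <= \sum_i w i * powR (x i) p.
Proof.
move=> x0 p1; set m := \sum_i w i * x i.
have [m0|m_gt0] : m = 0 \/ 0 < m.
- have : 0 <= m by apply: sumr_ge0 => i _; rewrite mulr_ge0.
  by rewrite le_eqVlt => /predU1P[]; [left|right].
- rewrite m0 powR0; first by apply: sumr_ge0 => i _; rewrite mulr_ge0 ?powR_ge0.
  by rewrite gt_eqF // (lt_le_trans ltr01).
(* Bernoulli's inequality at [u = x i / m], scaled by [powR m p]; this is why [m = 0] was split
   off. *)
have tangent i : powR m p * (1 + p * (x i / m - 1)) <= powR (x i) p.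
  have xm0 : 0 <= x i / m by rewrite divr_ge0 // ltW.
  have {2}-> : x i = m * (x i / m) by rewrite mulrC divfK ?gt_eqF.
  by rewrite powRM ?(ltW m_gt0) // ler_wpM2l ?powR_ge0 // powR_bernoulli.
apply: (@le_trans _ _ (\sum_i w i * (powR m p * (1 + p * (x i / m - 1))))).
  have -> : \sum_i w i * (powR m p * (1 + p * (x i / m - 1))) =
      \sum_i (powR m p * (1 - p) * w i + powR m p * p / m * (w i * x i)).
    by apply: eq_bigr => i _; ring.
  rewrite big_split /= -!mulr_sumr w1 -/m mulr1 divfK ?gt_eqF //.
  by rewrite -mulrDr subrK mulr1.
by apply: ler_sum => i _; rewrite ler_wpM2l.
Qed.

(** Jensen with exponent [t / s >= 1] for the values [powR (x i) s], followed by the monotone [t]-th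
    root. *)
Lemma power_mean_le (x : I -> R) s t : (forall i, 0 <= x i) -> 0 < s -> s <= t ->
  powR (\sum_i w i * powR (x i) s) s^-1 <=
  powR (\sum_i w i * powR (x i) t) t^-1.
Proof.
move=> x0 s0 st; have t0 : 0 < t := lt_le_trans s0 st.
have sum0 r : 0 <= \sum_i w i * powR (x i) r.
  by apply: sumr_ge0 => i _; rewrite mulr_ge0 ?powR_ge0.
have -> : s^-1 = t / s * t^-1 by rewrite mulrAC divff ?mul1r ?gt_eqF.
rewrite powRrM; apply: ge0_ler_powR.
- by rewrite invr_ge0 ltW.
- by rewrite nnegrE powR_ge0.
- by rewrite nnegrE.
apply: le_trans (_ : _ <= \sum_i w i * powR (powR (x i) s) (t / s)) _.
  by apply: powR_jensen; [move=> i; rewrite powR_ge0|rewrite ler_pdivlMr ?mul1r].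
rewrite le_eqVlt; apply/orP; left; apply/eqP; apply: eq_bigr => i _.
by rewrite -powRrM mulrCA divff ?mulr1 // gt_eqF.
Qed.

Lemma power_mean_le1 (x : I -> R) s : (forall i, 0 <= x i <= 1) -> 0 < s ->
  powR (\sum_i w i * powR (x i) s) s^-1 <= 1.
Proof.
move=> x01 s0; have le1 (y r : R) : 0 <= r -> 0 <= y -> y <= 1 -> powR y r <= 1.
  move=> r0 y0 y1; have <- : powR 1 r = 1 :> R by rewrite powR1.
  by apply: ge0_ler_powR; rewrite ?nnegrE.
apply: (le1); first by rewrite invr_ge0 ltW.
  by apply: sumr_ge0 => i _; rewrite mulr_ge0 ?powR_ge0.
rewrite -[leRHS]w1; apply: ler_sum => i _; have /andP[x0 x1] := x01 i.
by rewrite -[leRHS]mulr1 ler_wpM2l // le1 // ltW.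
Qed.

End PowerMean.

Section Spectral.
Local Open Scope sesquilinear_scope.
Context {R : realType} {d : nat}.
Implicit Types (A P : 'M[R[i]]_d) (D : 'rV[R[i]]_d) (v : 'cV[R[i]]_d).

Lemma trmxC_mulmx m n p (A : 'M[R[i]]_(m, n)) (B : 'M[R[i]]_(n, p)) :
  (A *m B)^t* = B^t* *m A^t*.
Proof. by rewrite trmx_mul map_mxM. Qed.

(** Used with three diagonals: the eigenvalues, a function of them, and the constant 1. *)
Lemma quadratic_form_diag P D v :
  (v^t* *m (P^t* *m diag_mx D *m P) *m v) 0 0 =
  \sum_i D 0 i * `|(P *m v) i 0| ^+ 2.
Proof.
rewrite !mulmxA -trmxC_mulmx -(mulmxA _ P) mxE.
move: (P *m v) => u; apply: eq_bigr => i _.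
by rewrite mul_mx_diag !mxE normCK mulrAC mulrC [X in _ * X]mulrC.
Qed.

Lemma psdmx_spectralE A : psdmx A ->
  A = (spectralmx A)^t* *m diag_mx (spectral_diag A) *m spectralmx A.
Proof.
move=> [Ah _]; rewrite -invmx_unitary ?spectral_unitarymx //.
exact/orthomx_spectralP/hermitian_normalmx.
Qed.

Lemma spectral_mulmxVC A : spectralmx A *m (spectralmx A)^t* = 1%:M.
Proof. exact/unitarymxP/spectral_unitarymx. Qed.

Lemma psdmx_spectral_diag_ge0 A i : psdmx A -> 0 <= spectral_diag A 0 i.
Proof.
(* Positivity is tested on the [i]-th eigenvector, where the form equals the [i]-th eigenvalue. *)
move=> Ap; have /(_ ((spectralmx A)^t* *m delta_mx i 0)) := Ap.2.
rewrite {2}(psdmx_spectralE A Ap) quadratic_form_diag mulmxA spectral_mulmxVC.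
rewrite mul1mx (bigD1 i) //= big1 => [|j /negPf ji].
  by rewrite mxE !eqxx normr1 expr1n mulr1 addr0.
by rewrite mxE ji normr0 expr0n mulr0.
Qed.

Lemma psdmx_trace A : psdmx A -> \tr A = \sum_i spectral_diag A 0 i.
Proof.
move=> Ap; rewrite {1}(psdmx_spectralE A Ap) mxtrace_mulC mulmxA.
by rewrite spectral_mulmxVC mul1mx mxtrace_diag.
Qed.

Definition eigenvalue_re A i : R := complex.Re (spectral_diag A 0 i).

(** The squared overlap of [v] with the [i]-th eigenvector: the Born probability when [v] is a unit
    vector. The real part only changes the type. *)
Definition eigen_weight A v i : R :=
  complex.Re (`|(spectralmx A *m v) i 0| ^+ 2).

Lemma eigen_weightE A v i :
  (eigen_weight A v i)%:C = `|(spectralmx A *m v) i 0| ^+ 2.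
Proof. by rewrite RRe_real // realX // normr_real. Qed.

Lemma eigen_weight_ge0 A v i : 0 <= eigen_weight A v i.
Proof. by rewrite -lecR eigen_weightE exprn_ge0. Qed.

Lemma sum_eigen_weight A v : (\sum_i eigen_weight A v i)%:C = (v^t* *m v) 0 0.
Proof.
rewrite rmorph_sum /=.
(* Parseval: with the constant diagonal 1, unitarity collapses the form to the squared norm of
   [v]. *)
have := quadratic_form_diag (spectralmx A) (const_mx 1) v.
rewrite diag_const_mx mulmx1 (mulmx1C (spectral_mulmxVC A)) mulmx1 => ->.
by apply: eq_bigr => i _; rewrite mxE mul1r eigen_weightE.
Qed.

Lemma expect_mxfun (f : R -> R) A v :
  expect v (mxfun f A) = \sum_i eigen_weight A v i * f (eigenvalue_re A i).
Proof.
apply: complexI; rewrite /expect /mxfun quadratic_form_diag.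
under eq_bigr do rewrite mxE -eigen_weightE -rmorphM mulrC.
by rewrite -rmorph_sum.
Qed.

Lemma density_eigenvalue_bounds A i :
  density_matrix A -> 0 <= eigenvalue_re A i <= 1.
Proof.
move=> [Ap Atr]; have l0 j : 0 <= eigenvalue_re A j.
  by have := psdmx_spectral_diag_ge0 A j Ap; rewrite lecE => /andP[].
(* The trace writes 1 as a sum of nonnegative eigenvalues, so none of them exceeds 1. *)
rewrite l0; have -> : 1 = \sum_j eigenvalue_re A j.
  by rewrite -[LHS]/(complex.Re (1 : R[i])) -Atr psdmx_trace // raddf_sum.
by rewrite (bigD1 i) //= lerDl sumr_ge0.
Qed.

Lemma f1_norm : (0 < d)%N -> ((f1 R d)^t* *m f1 R d) 0 0 = 1.
Proof.
move=> d0; have f1E i : f1 R d i 0 = ((Num.sqrt (d%:R : R))^-1)%:C.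
  rewrite mxE summxE (bigD1 i) //= big1 => [|j /negPf ji].
    by rewrite mxE !eqxx addr0 mulr1.
  by rewrite mxE eq_sym ji.
move: (f1 R d) f1E => u uE; rewrite mxE.
under eq_bigr do rewrite !mxE uE conj_Creal ?complex_real // -rmorphM.
rewrite -rmorph_sum sumr_const card_ord -expr2 exprVn sqr_sqrtr ?ler0n //.
by rewrite -[_ *+ d]mulr_natr mulVf ?rmorph1 // pnatr_eq0 -lt0n.
Qed.

End Spectral.

Theorem proposition8 (R : realType) (d : nat) (rho : 'M[R[i]]_d)
    (alpha1 alpha2 : R) :
  density_matrix rho ->
  2^-1 <= alpha1 -> alpha1 < 1 ->
  2^-1 <= alpha2 -> alpha2 < 1 ->
  alpha2 <= alpha1 ->
  texture_renyi alpha2 rho <= texture_renyi alpha1 rho.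
Proof.
move=> rhoD a1h a1lt a2h a2lt a21.
have a1_gt0 : 0 < alpha1 by lra.
have a2_gt0 : 0 < alpha2 by lra.
(* In dimension 0 the trace would be the empty sum 0; with [d] positive, [f1] is a unit vector. *)
have d0 : (0 < d)%N.
  rewrite lt0n; apply/eqP => d0; subst d; have := rhoD.2.
  by move/eqP; rewrite /mxtrace big_ord0 eq_sym oner_eq0.
pose w := eigen_weight rho (f1 R d).
have w0 i : 0 <= w i := eigen_weight_ge0 rho (f1 R d) i.
have w1 : \sum_i w i = 1.
  by apply: complexI; rewrite sum_eigen_weight f1_norm.
have l01 i := density_eigenvalue_bounds rho i rhoD.
have l0 i : 0 <= eigenvalue_re rho i by have /andP[] := l01 i.
have s1_gt0 : 0 < (1 - alpha1) / alpha1 by rewrite divr_gt0 // subr_gt0.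
have s2_gt0 : 0 < (1 - alpha2) / alpha2 by rewrite divr_gt0 // subr_gt0.
have s12 : (1 - alpha1) / alpha1 <= (1 - alpha2) / alpha2.
  by rewrite ler_pdivrMr // mulrAC ler_pdivlMr //; lra.
(* The outer exponent [alpha / (1 - alpha)] becomes the inverse of the inner one, which exposes the
   power mean. *)
rewrite /texture_renyi /mxpow !expect_mxfun -!(invf_div (1 - _)).
apply: ler_pM.
- by rewrite invr_ge0 subr_ge0 ltW.
- by rewrite subr_ge0 power_mean_le1.
- by rewrite lef_pV2 ?posrE ?subr_gt0 // lerB.
- by rewrite lerB // power_mean_le.
Qed.
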